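(* Let $\mathcal M=(M,<,+,0,\ldots)$ be a definably complete locally o-minimal expansion of an ordered group and let $(\Omega,\preceq)$ be a definable directed set. Then there exists a definable downward cofinal map $\gamma:(M^{>0}\times M^{>0},\unlhd)\to(\Omega,\preceq)$.
   Context: ''Definable'' means definable in $\mathcal M$ with parameters. $\mathcal M$ is an expansion of an ordered group with dense order without endpoints; locally o-minimal: for every definable $X\subseteq M$ and $a\in M$ there is an open interval $I\ni a$ with $X\cap I$ a finite union of points and open intervals; definably complete: every definable subset of $M$ has sup and inf in $M\cup\{\pm\infty\}$. $M^{>0}=\{x\in M: x>0\}$. A preorder is a reflexive transitive relation. A (downward) directed set $(\Omega,\preceq)$ is a nonempty set with a preorder such that every finite subset has an element $v$ with $v\preceq u$ for all $u$ in it; it is definable if $\Omega\subseteq M^n$ and $\preceq$ are definable. On $M^{>0}\times M^{>0}$, $(s,t)\unlhd(s',t')$ iff $s\le s'$ and $t\ge t'$. A map $\gamma:(\Omega',\preceq')\to(\Omega,\preceq)$ is downward cofinal if for every $u\in\Omega$ there is $v\in\Omega'$ such that $w\preceq' v$ implies $\gamma(w)\preceq u$. *)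

(* Defs.v *)
From mathcomp Require Import all_boot.
From Stdlib Require Import List.

Set Implicit Arguments.
Unset Strict Implicit.
Unset Printing Implicit Defensive.

(* Tuples in M^n are functions 'I_n -> M.  Subsets of M^n are predicates. *)

Section Defs.
Variable M : Type.
Variable lt : M -> M -> Prop.
Variable add : M -> M -> M.
Variable zero : M.
Variable opp : M -> M.

Definition le (x y : M) : Prop := lt x y \/ x = y.

Definition cat_tup (m n : nat) (x : 'I_m -> M) (y : 'I_n -> M) : 'I_(m + n) -> M :=
  fun i => match fintype.split i with inl j => x j | inr k => y k end.

Definition lpart (m n : nat) (z : 'I_(m + n) -> M) : 'I_m -> M := fun i => z (lshift n i).
Definition rpart (m n : nat) (z : 'I_(m + n) -> M) : 'I_n -> M := fun i => z (rshift m i).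

Definition ordered_group : Prop :=
  ((forall x, ~ lt x x) /\
      (forall x y z, lt x y -> lt y z -> lt x z) /\
      (forall x y, lt x y \/ x = y \/ lt y x) /\
      (forall x y z, add x (add y z) = add (add x y) z) /\
      (forall x, add zero x = x /\ add x zero = x) /\
      (forall x, add (opp x) x = zero /\ add x (opp x) = zero) /\
      (forall x y z, lt x y -> lt (add z x) (add z y) /\ lt (add x z) (add y z))).

Definition dense_no_endpoints : Prop :=
  (forall x y, lt x y -> exists z, lt x z /\ lt z y) /\
  (forall x, exists y z, lt y x /\ lt x z).

(* The family Def n of subsets of M^n definable (with parameters) in some
   expansion of (M,<,+,0): the standard axiomatization of a "structure on M"
   (van den Dries): Boolean algebras, closed under coordinate substitutions
   (products with M, permutations, diagonals), projections, containing the
   points, equality, the order and the graph of +. *)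
Definition definable_structure (Def : forall n : nat, (('I_n -> M) -> Prop) -> Prop) : Prop :=
  ((forall n (A B : ('I_n -> M) -> Prop), Def n A -> (forall x, A x <-> B x) -> Def n B) /\
      (forall n, Def n (fun _ => True)) /\
      (forall n A, Def n A -> Def n (fun x => ~ A x)) /\
      (forall n A B, Def n A -> Def n B -> Def n (fun x => A x /\ B x)) /\
      (forall n m (sigma : 'I_n -> 'I_m) A, Def n A -> Def m (fun y => A (fun i => y (sigma i)))) /\
      (forall n m A, Def (n + m) A -> Def n (fun x => exists y : 'I_m -> M, A (cat_tup x y))) /\
      (forall a : M, Def 1 (fun x => x ord0 = a)) /\
      Def 2 (fun x => x ord0 = x ord_max) /\
      Def 2 (fun x => lt (x ord0) (x ord_max)) /\
      Def 3 (fun x => add (x ord0) (x (@Ordinal 3 1 isT)) = x ord_max)).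

Definition Def1 (Def : forall n : nat, (('I_n -> M) -> Prop) -> Prop) (X : M -> Prop) : Prop :=
  Def 1 (fun x => X (x ord0)).

Definition locally_o_minimal (Def : forall n : nat, (('I_n -> M) -> Prop) -> Prop) : Prop :=
  forall X : M -> Prop, Def1 Def X -> forall a : M,
    exists b c, lt b a /\ lt a c /\
      exists (pts : list M) (ivs : list (M * M)),
        forall x, (X x /\ lt b x /\ lt x c) <->
                  (List.In x pts \/ exists pq, List.In pq ivs /\ lt pq.1 x /\ lt x pq.2).

(* every definable subset of M has sup and inf in M ∪ {±∞}; written out:
   nonempty bounded-above (resp. below) definable sets have a sup (resp. inf)
   in M (the empty / unbounded cases are handled by ±∞). *)
Definition definably_complete (Def : forall n : nat, (('I_n -> M) -> Prop) -> Prop) : Prop :=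
  forall X : M -> Prop, Def1 Def X -> (exists x, X x) ->
    ((exists b, forall x, X x -> le x b) ->
       exists s, (forall x, X x -> le x s) /\ (forall b, (forall x, X x -> le x b) -> le s b)) /\
    ((exists b, forall x, X x -> le b x) ->
       exists s, (forall x, X x -> le s x) /\ (forall b, (forall x, X x -> le b x) -> le b s)).

Definition definable_directed_set (Def : forall n : nat, (('I_n -> M) -> Prop) -> Prop)
  (n : nat) (Omega : ('I_n -> M) -> Prop) (pre : ('I_n -> M) -> ('I_n -> M) -> Prop) : Prop :=
  (Def n Omega /\
      Def (n + n) (fun z => pre (lpart z) (rpart z)) /\
      (forall u, Omega u -> pre u u) /\
      (forall u v w, Omega u -> Omega v -> Omega w -> pre u v -> pre v w -> pre u w) /\
      (exists u, Omega u) /\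
      (forall s : list ('I_n -> M), (forall u, List.In u s -> Omega u) ->
         exists v, Omega v /\ forall u, List.In u s -> pre v u)).

Definition unlhd (p q : M * M) : Prop := le p.1 q.1 /\ le q.2 p.2.

Definition definable_map_pos (Def : forall n : nat, (('I_n -> M) -> Prop) -> Prop)
  (n : nat) (gamma : M -> M -> ('I_n -> M)) : Prop :=
  Def (2 + n) (fun z => lt zero (lpart z ord0) /\ lt zero (lpart z ord_max) /\
                        forall i, rpart z i = gamma (lpart z ord0) (lpart z ord_max) i).

Definition downward_cofinal_pos (n : nat) (Omega : ('I_n -> M) -> Prop)
  (pre : ('I_n -> M) -> ('I_n -> M) -> Prop) (gamma : M -> M -> ('I_n -> M)) : Prop :=
  forall u, Omega u -> exists s0 t0, lt zero s0 /\ lt zero t0 /\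
    forall s t, lt zero s -> lt zero t -> unlhd (s, t) (s0, t0) -> pre (gamma s t) u.

End Defs.

(* Main.v *)
(** It suffices to exhaust Omega by definable sets K_(s,t), growing as s
    decreases to 0 and t increases, each of which has a lower bound in Omega:
    definable choice then selects gamma(s,t) among the lower bounds of K_(s,t).

    The exhaustion is built one coordinate at a time.  If L_(a,s,t) exhausts the
    fibre of Omega over the coordinate value a, let B be the set of values b such
    that, for some s and t, no neighbourhood I of b makes the union of the
    L_(a,s,t), a in I, bounded below.  The union of the L_(a,s,t) over the a with
    |a| <= t that are not within s of a point of B other than a is then bounded
    below by a compactness argument, and these unions exhaust Omega as soon as B
    is discrete, i.e. contains no interval.

    An increasing union of definable subsets of M without interior has no
    interior, so it is enough to fix s and t.  If all points of an interval U
    were bad, then for each w in Omega the set D_w of those a in U for which w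
    bounds L_(a,s,t) would have no interior, whereas every finite subset of U
    lies in some D_w by directedness.  A dimension count forbids this for
    n + 1 well-chosen points. *)

Require Import Defs.
From mathcomp Require Import all_boot.
From Stdlib Require Import List.
From Stdlib Require Import Classical ClassicalEpsilon FunctionalExtensionality.

Section LocallyOMinimal.
Context (M : Type) (lt : M -> M -> Prop) (add : M -> M -> M).
Context (Def : forall n : nat, (('I_n -> M) -> Prop) -> Prop).
Context (HDef : definable_structure lt add Def).

(** * Definable predicates and terms *)

Definition shift (m : nat) (r : nat -> M) : nat -> M := fun k => r (m + k).

Definition scons (x : M) (r : nat -> M) : nat -> M :=
  fun k => if k is k'.+1 then r k' else x.

(* Formulas are predicates on environments r : nat -> M that depend only on
   finitely many variables; binding a variable shifts the environment. *)
Definition defpred (P : (nat -> M) -> Prop) : Prop :=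
  exists n (A : ('I_n -> M) -> Prop),
    Def n A /\ forall r, P r <-> A (fun i => r i).

Definition defterm (f : (nat -> M) -> M) : Prop :=
  defpred (fun r => r 0 = f (shift 1 r)).

Lemma defpred_ext P Q : defpred P -> (forall r, P r <-> Q r) -> defpred Q.
Proof.
move=> [n [A [dA eA]]] PQ; exists n, A; split=> // r.
by rewrite -PQ.
Qed.

Lemma defpred_widen P : defpred P ->
  exists n, forall m, n <= m -> exists A : ('I_m -> M) -> Prop,
    Def m A /\ forall r, P r <-> A (fun i => r i).
Proof.
move=> [n [A [dA eA]]]; exists n => m le_nm.
exists (fun y => A (fun i => y (widen_ord le_nm i))); split.
  by case: HDef => _ [_ [_ [_ [H _]]]]; exact: H.
by move=> r; rewrite eA.
Qed.

Lemma defpred_not P : defpred P -> defpred (fun r => ~ P r).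
Proof.
move=> [n [A [dA eA]]]; exists n, (fun x => ~ A x); split.
  by case: HDef => _ [_ [H _]]; exact: H.
by move=> r; rewrite eA.
Qed.

Lemma defpred_and P Q : defpred P -> defpred Q -> defpred (fun r => P r /\ Q r).
Proof.
move=> /defpred_widen [n HP] /defpred_widen [m HQ].
have [A [dA eA]] := HP (maxn n m) (leq_maxl _ _).
have [B [dB eB]] := HQ (maxn n m) (leq_maxr _ _).
exists (maxn n m), (fun x => A x /\ B x); split.
  by case: HDef => _ [_ [_ [H _]]]; exact: H.
by move=> r; rewrite eA eB.
Qed.

Lemma defpred_or P Q : defpred P -> defpred Q -> defpred (fun r => P r \/ Q r).
Proof.
move=> dP dQ.
apply: (@defpred_ext (fun r => ~ (~ P r /\ ~ Q r))).
  by apply: defpred_not; apply: defpred_and; apply: defpred_not.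
by move=> r; case: (classic (P r)); case: (classic (Q r)); tauto.
Qed.

Lemma defpred_imp P Q : defpred P -> defpred Q -> defpred (fun r => P r -> Q r).
Proof.
move=> dP dQ.
apply: (@defpred_ext (fun r => ~ P r \/ Q r)).
  by apply: defpred_or => //; apply: defpred_not.
by move=> r; case: (classic (P r)); tauto.
Qed.

Lemma defpred_const (p : Prop) : defpred (fun _ => p).
Proof.
have dT : defpred (fun _ => True).
  exists 0, (fun _ => True); split=> //.
  by case: HDef => _ [H _]; exact: H.
case: (classic p) => hp; first by apply: defpred_ext dT _.
apply: (@defpred_ext (fun _ => ~ True)); first exact: defpred_not.
by move=> r; tauto.
Qed.

Lemma defpred_exists (P : (nat -> M) -> M -> Prop) :
  defpred (fun r => P (shift 1 r) (r 0)) -> defpred (fun r => exists x, P r x).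
Proof.
move=> /defpred_widen [n HP].
have [A [dA eA]] := HP (n + 1) (leq_addr _ _).
(* [Def] projects away the last coordinates while the bound variable is variable 0, so [sg] rotates
   variable 0 to the end. *)
pose sg (i : 'I_(n + 1)) : 'I_(n + 1) :=
  match fintype.split (cast_ord (addnC n 1) i) with
  | inl _ => rshift n ord0 | inr k => lshift 1 k end.
have dB : Def (n + 1) (fun y => A (fun i => y (sg i))).
  by case: HDef => _ [_ [_ [_ [H _]]]]; exact: H.
exists n, (fun x => exists y : 'I_1 -> M,
  (fun y => A (fun i => y (sg i))) (cat_tup x y)); split.
  by case: HDef => _ [_ [_ [_ [_ [H _]]]]]; exact: (H _ _ _ dB).
have key (r : nat -> M) x :
    (fun i => cat_tup (fun i : 'I_n => r i) (fun _ : 'I_1 => x) (sg i))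
    = (fun i : 'I_(n + 1) => scons x r i).
  apply: functional_extensionality => i; rewrite /sg.
  case: splitP => [j ej|k ek]; rewrite /cat_tup.
    have -> : fintype.split (rshift n ord0 : 'I_(n + 1)) = inr ord0
      := unsplitK (inr ord0).
    rewrite /= in ej.
    by rewrite ej; case: j {ej} => [[|?] ?].
  have -> : fintype.split (lshift 1 k) = inl k := unsplitK (inl k).
  by rewrite /= in ek; rewrite ek.
move=> r; split=> [[x Px]|[y]].
  exists (fun _ => x); rewrite /= key -eA.
  exact: Px.
have -> : y = fun _ => y ord0.
  by apply: functional_extensionality => i; rewrite (ord1 i).
by rewrite /= key -eA => Px; exists (y ord0); exact: Px.
Qed.

Lemma defpred_forall (P : (nat -> M) -> M -> Prop) :
  defpred (fun r => P (shift 1 r) (r 0)) -> defpred (fun r => forall x, P r x).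
Proof.
move=> dP; apply: (@defpred_ext (fun r => ~ exists x, ~ P r x)).
  by apply: defpred_not; apply: defpred_exists; exact: defpred_not.
move=> r; split=> [H x|H [x]]; last exact.
by apply: NNPP => Hx; apply: H; exists x.
Qed.

Lemma defpred_rename (f : nat -> nat) P :
  defpred P -> defpred (fun r => P (fun k => r (f k))).
Proof.
move=> [n [A [dA eA]]].
(* The successor makes room for every [f i] and keeps ['I_m] nonempty, as [inord] requires. *)
pose m := (\max_(i < n) f i).+1.
exists m, (fun y => A (fun i => y (inord (f i)))); split.
  case: HDef => _ [_ [_ [_ [H _]]]].
  exact: (H _ _ (fun i : 'I_n => inord (f i) : 'I_m) _ dA).
move=> r; rewrite eA.
suff -> : (fun i : 'I_n => r (f i))
          = (fun i => r (inord (f i) : 'I_m)) by [].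
apply: functional_extensionality => i; rewrite inordK //.
by rewrite ltnS (leq_bigmax i).
Qed.

Lemma defpred_forall_ord (n : nat) (P : 'I_n -> (nat -> M) -> Prop) :
  (forall i, defpred (P i)) -> defpred (fun r => forall i, P i r).
Proof.
move=> dP.
have H (s : list 'I_n) : defpred (fun r => forall i, i \in s -> P i r).
  elim: s => [|j s IH].
    by apply: defpred_ext (defpred_const True) _ => r; split.
  apply: defpred_ext (defpred_and _ _ (dP j) IH) _ => r; split.
    by move=> [Pj Ps] i; rewrite inE => /orP [/eqP ->|/Ps].
  by move=> Ps; split=> [|i si]; apply: Ps; rewrite inE ?eqxx // si orbT.
apply: defpred_ext (H (enum 'I_n)) _ => r; split=> Ps i //.
by apply: Ps; rewrite mem_enum.
Qed.

Lemma defpred_exists_tuple m (P : (nat -> M) -> ('I_m -> M) -> Prop) :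
  defpred (fun r => P (shift m r) (fun i => r i)) ->
  defpred (fun r => exists w, P r w).
Proof.
elim: m P => [|m IH] P dP.
  apply: (@defpred_ext (fun r => P r (fun i => r i))); first exact: dP.
  move=> r; split=> [Pw|[w Pw]]; first by exists (fun i => r i).
  suff -> : (fun i : 'I_0 => r i) = w by [].
  by apply: functional_extensionality => -[].
pose cons (x : M) (w : 'I_m -> M) : 'I_m.+1 -> M :=
  fun i => if unlift ord0 i is Some j then w j else x.
apply: (@defpred_ext (fun r => exists x w, P r (cons x w))).
  apply: defpred_exists; apply: IH.
  (* Under the two binders [w] occupies variables 0 to m - 1 and [x] variable m, whereas [dP]
     expects [x] first. *)
  pose g k := if k is k'.+1 then (if k' < m then k' else k) else m.
  apply: (defpred_ext _ _ (defpred_rename g _ dP)) => r.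
  rewrite /cons /shift /=.
  have -> : (fun k => r (if m + k < m then m + k else (m + k).+1))
            = (fun k => r (m + (1 + k))).
    apply: functional_extensionality => k.
    by rewrite ltnNge leq_addr /= add1n addnS.
  suff -> : (fun i : 'I_m.+1 => r (g i)) = fun i : 'I_m.+1 =>
      match unlift ord0 i with Some j => r j | None => r (m + 0) end by [].
  apply: functional_extensionality => i.
  case: unliftP => [j ->|->] /=; last by rewrite addn0.
  by rewrite /bump /= ltn_ord.
move=> r; split=> [[x [w Pw]]|[w Pw]]; first by exists (cons x w).
exists (w ord0), (fun j => w (lift ord0 j)).
suff -> : cons (w ord0) (fun j => w (lift ord0 j)) = w by [].
apply: functional_extensionality => i; rewrite /cons.
by case: unliftP => [j ->|->].
Qed.

Lemma defpred_forall_tuple m (P : (nat -> M) -> ('I_m -> M) -> Prop) :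
  defpred (fun r => P (shift m r) (fun i => r i)) ->
  defpred (fun r => forall w, P r w).
Proof.
move=> dP; apply: (@defpred_ext (fun r => ~ exists w, ~ P r w)).
  by apply: defpred_not; apply: defpred_exists_tuple; exact: defpred_not.
move=> r; split=> [H x|H [x]]; last exact.
by apply: NNPP => Hx; apply: H; exists x.
Qed.

(** Only finitely many variables matter, so the substituted values can be named by a quantified
    tuple. *)
Lemma defpred_subst (F : (nat -> M) -> nat -> M) P :
  (forall k, defterm (fun r => F r k)) -> defpred P ->
  defpred (fun r => P (F r)).
Proof.
move=> dF [n [A [dA eA]]].
apply: (@defpred_ext (fun r => exists w : 'I_n -> M,
                        (forall i, w i = F r i) /\ A w)).
  apply: defpred_exists_tuple; apply: defpred_and; last first.
    by exists n, A.
  apply: defpred_forall_ord => i.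
  pose g k := if k is k'.+1 then n + k' else val i.
  apply: (defpred_ext _ _ (defpred_rename g _ (dF i))) => r.
  by rewrite /shift.
move=> r; rewrite eA; split=> [[w [ew Aw]]|AF].
  suff <- : w = (fun i => F r i) by [].
  exact: functional_extensionality.
by exists (fun i => F r i).
Qed.

Lemma defterm_subst (F : (nat -> M) -> nat -> M) f :
  (forall k, defterm (fun r => F r k)) -> defterm f ->
  defterm (fun r => f (F r)).
Proof.
move=> dF df.
pose F' r k := if k is k'.+1 then F (shift 1 r) k' else r 0.
apply: (@defpred_subst F' _ _ df) => -[|k].
  suff H : defpred (fun r => r 0 = r 1) by exact: H.
  have [_ [_ [_ [_ [_ [_ [_ [H _]]]]]]]] := HDef.
  by exists 2, (fun x => x ord0 = x ord_max).
pose g k := if k is k'.+1 then k'.+2 else 0.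
exact: (defpred_rename g _ (dF k)).
Qed.

Lemma defterm_var k : defterm (fun r => r k).
Proof.
suff H : defpred (fun r => r 0 = r 1).
  by apply: (defpred_rename (fun j => if j is 0 then 0 else k.+1) _ H).
have [_ [_ [_ [_ [_ [_ [_ [H _]]]]]]]] := HDef.
by exists 2, (fun x => x ord0 = x ord_max).
Qed.

Lemma defterm_const a : defterm (fun _ => a).
Proof.
have [_ [_ [_ [_ [_ [_ [H _]]]]]]] := HDef.
by exists 1, (fun x => x ord0 = a).
Qed.

Definition env2 (x y : M) : nat -> M := scons x (fun _ => y).

Lemma defterm_add f g : defterm f -> defterm g ->
  defterm (fun r => add (f r) (g r)).
Proof.
move=> df dg.
have H0 : defterm (fun r => add (r 0) (r 1)).
  have [_ [_ [_ [_ [_ [_ [_ [_ [_ H]]]]]]]]] := HDef.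
  apply: (defpred_ext (fun r => add (r 1) (r 2) = r 0)); last by split.
  apply: (defpred_rename (fun k => match k with 0 => 1 | 1 => 2 | _ => 0 end)
            (fun r => add (r 0) (r 1) = r 2)).
  by exists 3; eexists; split; first exact: H.
by apply: (@defterm_subst (fun r => env2 (f r) (g r)) _ _ H0) => -[|k].
Qed.

Lemma defpred_lt f g : defterm f -> defterm g ->
  defpred (fun r => lt (f r) (g r)).
Proof.
move=> df dg.
have H0 : defpred (fun r => lt (r 0) (r 1)).
  have [_ [_ [_ [_ [_ [_ [_ [_ [H _]]]]]]]]] := HDef.
  by exists 2; eexists; split; first exact: H.
by apply: (@defpred_subst (fun r => env2 (f r) (g r)) _ _ H0) => -[|k].
Qed.

Lemma defpred_eq f g : defterm f -> defterm g ->
  defpred (fun r => f r = g r).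
Proof.
move=> df dg; have H0 := defterm_var 0.
by apply: (@defpred_subst (fun r => env2 (f r) (g r)) _ _ H0) => -[|k].
Qed.

Lemma defpred_le f g : defterm f -> defterm g ->
  defpred (fun r => le lt (f r) (g r)).
Proof.
by move=> df dg; apply: defpred_or; [apply: defpred_lt|apply: defpred_eq].
Qed.

Lemma defterm_scons x F k : defterm x ->
  (forall k, defterm (fun r => F r k)) ->
  defterm (fun r => scons (x r) (F r) k).
Proof. by move=> dx dF; case: k. Qed.

Lemma defterm_shift F m k :
  (forall k, defterm (fun r => F r k)) ->
  defterm (fun r => shift m (F r) k).
Proof. by move=> dF; exact: dF. Qed.

Definition def1 (X : M -> Prop) := defpred (fun r => X (r 0)).
Definition def2 (X : M -> M -> Prop) := defpred (fun r => X (r 0) (r 1)).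
Definition deffam m (W : (nat -> M) -> ('I_m -> M) -> Prop) :=
  defpred (fun r => W (shift m r) (fun i => r i)).

Lemma defpred_app1 X f : def1 X -> defterm f -> defpred (fun r => X (f r)).
Proof.
by move=> dX df; apply: (@defpred_subst (fun r _ => f r) _ _ dX).
Qed.

Lemma defpred_app2 X f g : def2 X -> defterm f -> defterm g ->
  defpred (fun r => X (f r) (g r)).
Proof.
by move=> dX df dg;
  apply: (@defpred_subst (fun r => env2 (f r) (g r)) _ _ dX) => -[|k].
Qed.

Lemma defpred_appfam m W F (w : (nat -> M) -> 'I_m -> M) : deffam m W ->
  (forall k, defterm (fun r => F r k)) -> (forall i, defterm (fun r => w r i)) ->
  defpred (fun r => W (F r) (w r)).
Proof.
move=> dW dF dw.
pose G r k := if insub k is Some i then w r i else F r (k - m).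
apply: (defpred_ext _ _ (@defpred_subst G _ _ dW)).
  move=> k; rewrite /G; case: insubP => [i _ _|_]; [exact: dw|exact: dF].
move=> r.
have -> : shift m (G r) = F r.
  apply: functional_extensionality => k.
  by rewrite /shift /G insubN ?addKn // -leqNgt leq_addr.
suff -> : (fun i : 'I_m => G r i) = w r by [].
by apply: functional_extensionality => i; rewrite /G valK.
Qed.

Definition deffam1 (X : (nat -> M) -> M -> Prop) :=
  defpred (fun r => X (shift 1 r) (r 0)).

Lemma defpred_appfam1 X F f : deffam1 X ->
  (forall k, defterm (fun r => F r k)) -> defterm f ->
  defpred (fun r => X (F r) (f r)).
Proof.
move=> dX dF df.
by apply: (@defpred_subst (fun r => scons (f r) (F r)) _ _ dX) => -[|k] /=.
Qed.

Definition defset m (W : ('I_m -> M) -> Prop) := deffam m (fun _ => W).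
Definition defpair m (D : ('I_m -> M) -> M -> Prop) :=
  deffam m (fun r w => D w (r 0)).
(** The second argument is read from the parameters, which makes a relation an instance of
    [deffam]. *)
Definition defrel m (R : ('I_m -> M) -> ('I_m -> M) -> Prop) :=
  deffam m (fun r u => R u (fun i => r i)).

Lemma defpred_appset m W (w : (nat -> M) -> 'I_m -> M) : defset m W ->
  (forall i, defterm (fun r => w r i)) -> defpred (fun r => W (w r)).
Proof.
move=> dW dw.
exact: (defpred_appfam m (fun _ => W) (fun r => r) w dW defterm_var dw).
Qed.

Lemma defpred_apppair m D (w : (nat -> M) -> 'I_m -> M) f : defpair m D ->
  (forall i, defterm (fun r => w r i)) -> defterm f ->
  defpred (fun r => D (w r) (f r)).
Proof.
move=> dD dw df.
exact: (defpred_appfam m (fun r w => D w (r 0)) (fun r _ => f r) w dD (fun _ => df) dw).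
Qed.

Lemma defpred_apprel m R (u v : (nat -> M) -> 'I_m -> M) : defrel m R ->
  (forall i, defterm (fun r => u r i)) -> (forall i, defterm (fun r => v r i)) ->
  defpred (fun r => R (u r) (v r)).
Proof.
move=> dR du dv.
pose F r k := if insub k is Some i then v r i else r 0.
have dF k : defterm (fun r => F r k).
  by rewrite /F; case: insubP => [i _ _|_]; last exact: defterm_var.
apply: (defpred_ext _ _ (defpred_appfam m (fun r u => R u (fun i => r i)) F u dR dF du)) => r.
 suff -> : (fun i : 'I_m => F r i) = v r by [].
by apply: functional_extensionality => i; rewrite /F valK.
Qed.

Lemma def1_Def1 X : def1 X -> Def1 Def X.
Proof.
move=> [n [A [dA eA]]].
have [H0 [_ [_ [_ [H _]]]]] := HDef.
apply: (H0 _ _ _ (H _ _ (fun _ : 'I_n => ord0 : 'I_1) _ dA)) => x.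
by rewrite (eA (fun _ => x ord0)).
Qed.

(** Indices above n fall back to coordinate 0 under [inord]. *)
Lemma defpred_Def n P : defpred P -> Def n.+1 (fun z => P (fun k => z (inord k))).
Proof.
move=> [m [A [dA eA]]].
have [H0 [_ [_ [_ [H _]]]]] := HDef.
apply: (H0 _ _ _ (H _ n.+1 (fun i : 'I_m => inord i) _ dA)) => z.
by rewrite (eA (fun k => z (inord k))).
Qed.

(** * Ordered group arithmetic *)

Context (zero : M) (opp : M -> M).
Context (Hgrp : ordered_group lt add zero opp).
Context (Hdense : dense_no_endpoints lt).

Local Infix "≺" := lt (at level 70).
Local Infix "≼" := (le lt) (at level 70).

Lemma lt_irr x : ~ x ≺ x. Proof. by case: Hgrp. Qed.
Lemma lt_trans y x z : x ≺ y -> y ≺ z -> x ≺ z.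
Proof. by case: Hgrp => _ [H _]; exact: H. Qed.
Lemma lt_total x y : x ≺ y \/ x = y \/ y ≺ x.
Proof. by case: Hgrp => _ [_ [H _]]. Qed.
Lemma addA x y z : add x (add y z) = add (add x y) z.
Proof. by case: Hgrp => _ [_ [_ [H _]]]. Qed.
Lemma add0l x : add zero x = x.
Proof. by case: Hgrp => _ [_ [_ [_ [H _]]]]; case: (H x). Qed.
Lemma add0r x : add x zero = x.
Proof. by case: Hgrp => _ [_ [_ [_ [H _]]]]; case: (H x). Qed.
Lemma addNl x : add (opp x) x = zero.
Proof. by case: Hgrp => _ [_ [_ [_ [_ [H _]]]]]; case: (H x). Qed.
Lemma addNr x : add x (opp x) = zero.
Proof. by case: Hgrp => _ [_ [_ [_ [_ [H _]]]]]; case: (H x). Qed.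
Lemma lt_add2l z x y : x ≺ y -> add z x ≺ add z y.
Proof. by case: Hgrp => _ [_ [_ [_ [_ [_ H]]]]] /(H _ _ z) []. Qed.
Lemma lt_add2r z x y : x ≺ y -> add x z ≺ add y z.
Proof. by case: Hgrp => _ [_ [_ [_ [_ [_ H]]]]] /(H _ _ z) []. Qed.
Lemma le_add2l z x y : x ≼ y -> add z x ≼ add z y.
Proof. by case=> [/(lt_add2l z)|->]; [left|right]. Qed.
Lemma le_add2r z x y : x ≼ y -> add x z ≼ add y z.
Proof. by case=> [/(lt_add2r z)|->]; [left|right]. Qed.
Lemma dense x y : x ≺ y -> exists z, x ≺ z /\ z ≺ y.
Proof. by case: Hdense => H _; exact: H. Qed.
Lemma no_max x : exists y, x ≺ y.
Proof. by case: Hdense => _ /(_ x) [y [z [? ?]]]; exists z. Qed.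

Lemma not_lt x y : ~ x ≺ y -> y ≼ x.
Proof. by rewrite /le; case: (lt_total x y) => [|[->|]]; tauto. Qed.
Lemma not_le x y : ~ x ≼ y -> y ≺ x.
Proof. by rewrite /le; case: (lt_total x y) => [|[->|]]; tauto. Qed.
Lemma le_trans y x z : x ≼ y -> y ≼ z -> x ≼ z.
Proof.
case=> [xy|->] //; case=> [yz|<-]; left => //; exact: lt_trans yz.
Qed.
Lemma lt_le_trans y x z : x ≺ y -> y ≼ z -> x ≺ z.
Proof. by move=> xy [yz|<-] //; exact: lt_trans yz. Qed.
Lemma le_lt_trans y x z : x ≼ y -> y ≺ z -> x ≺ z.
Proof. by move=> [xy|->] // yz; exact: lt_trans yz. Qed.
Lemma le_refl x : x ≼ x. Proof. by right. Qed.
Lemma le_anti x y : x ≼ y -> y ≼ x -> x = y.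
Proof. by move=> [xy|//] [yx|//]; case: (lt_irr x); exact: lt_trans yx. Qed.

(** The tactic [ord] closes the hypotheses and the negated goal under transitivity until some x < x
    appears; facts already present are refused, so that this ends. *)
Ltac ord_new T p := lazymatch goal with
  | _ : T |- _ => fail
  | _ => pose proof (p : T) end.

Ltac ord_sat := match goal with
  | H : lt ?x ?x |- _ => exact (False_ind _ (lt_irr x H))
  | H1 : lt ?x ?y, H2 : lt ?y ?z |- _ => ord_new (lt x z) (lt_trans y x z H1 H2)
  | H1 : lt ?x ?y, H2 : le lt ?y ?z |- _ =>
      ord_new (lt x z) (lt_le_trans y x z H1 H2)
  | H1 : le lt ?x ?y, H2 : lt ?y ?z |- _ =>
      ord_new (lt x z) (le_lt_trans y x z H1 H2)
  | H1 : le lt ?x ?y, H2 : le lt ?y ?z |- _ =>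
      ord_new (le lt x z) (le_trans y x z H1 H2)
  end.

Ltac ord := intros; repeat match goal with
    | H : _ /\ _ |- _ => destruct H
    | H : ~ lt _ _ |- _ => apply not_lt in H
    | H : ~ le lt _ _ |- _ => apply not_le in H end;
  repeat match goal with
    | H : @eq M ?x ?y |- _ =>
        pose proof (or_intror H : le lt x y);
        pose proof (or_intror (esym H) : le lt y x); clear H end;
  repeat match goal with |- _ /\ _ => split end;
  lazymatch goal with
  | |- lt ?x ?y => apply NNPP; let H := fresh in intro H; apply not_lt in H
  | |- le lt ?x ?y => apply NNPP; let H := fresh in intro H; apply not_le in H
  | |- @eq M ?x ?y => apply le_anti; apply NNPP; let H := fresh in intro H; apply not_le in H
  | |- ~ _ => let H := fresh in intro H
  | |- False => idtac end;
  solve [repeat ord_sat].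

Lemma lt_min a b c : a ≺ b -> a ≺ c -> exists d, a ≺ d /\ d ≼ b /\ d ≼ c.
Proof.
move=> ab ac; case: (lt_total b c) => bc; [exists b|exists c].
  by split=> //; split; [right|left].
by split=> //; case: bc => [->|bc]; split; try (by right); left.
Qed.

Lemma defterm_opp f : defterm f -> defterm (fun r => opp (f r)).
Proof.
move=> df; suff H : defterm (fun r => opp (r 0)).
  exact: (@defterm_subst (fun r _ => f r) _ _ H).
apply: (@defpred_ext (fun r => add (r 0) (r 1) = zero)).
  apply: defpred_eq; last exact: defterm_const.
  by apply: defterm_add; exact: defterm_var.
move=> r; rewrite /shift /=; split=> [H|->]; last by rewrite addNl.
by rewrite -[LHS]add0r -(addNr (r 1)) addA H add0l.
Qed.

(** Sets with interior are the large sets of the line; definable sets without interior turn out to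
    be closed and discrete. *)
Definition has_interval (P : M -> Prop) :=
  exists a b, a ≺ b /\ forall x, a ≺ x -> x ≺ b -> P x.

Lemma has_interval_sub (P Q : M -> Prop) :
  (forall x, P x -> Q x) -> has_interval P -> has_interval Q.
Proof. by move=> PQ [a [b [ab H]]]; exists a, b; split=> // x xa xb; exact/PQ/H. Qed.

Lemma defpred_has_interval (P : (nat -> M) -> M -> Prop) :
  defpred (fun r => P (shift 1 r) (r 0)) -> defpred (fun r => has_interval (P r)).
Proof.
move=> dP.
apply: defpred_exists; apply: defpred_exists; apply: defpred_and.
  by apply: defpred_lt; exact: defterm_var.
apply: defpred_forall; apply: defpred_imp.
  by apply: defpred_lt; exact: defterm_var.
apply: defpred_imp; first by apply: defpred_lt; exact: defterm_var.
(* Three variables have been bound; [P] keeps the innermost, and its parameters now start at index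
   3. *)
exact: (defpred_rename (fun k => if k is k'.+1 then k'.+3 else 0) _ dP).
Qed.

(** Definability is proved by recursion on the syntax of the formula, with hypotheses for its atomic
    families. *)
Ltac dfn_step := match goal with
  | |- forall _, _ => intro; cbv beta
  | |- def1 _ => unfold def1
  | |- def2 _ => unfold def2
  | |- deffam _ _ => unfold deffam
  | |- deffam1 _ => unfold deffam1
  | |- defset _ _ => unfold defset, deffam
  | |- defpair _ _ => unfold defpair, deffam
  | |- defpred (fun _ => ?p) => apply (defpred_const p)
  | |- defpred (fun r => @?A r /\ @?B r) => apply (defpred_and A B); cbv beta
  | |- defpred (fun r => @?A r \/ @?B r) => apply (defpred_or A B); cbv beta
  | |- defpred (fun r => ~ @?A r) => apply (defpred_not A); cbv beta
  | |- defpred (fun r => exists x : M, @?P r x) => apply (defpred_exists P); cbv beta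
  | |- defpred (fun r => forall x : M, @?P r x) => apply (defpred_forall P); cbv beta
  | |- defpred (fun r => exists x : 'I_?m -> M, @?P r x) =>
      apply (defpred_exists_tuple m P); cbv beta
  | |- defpred (fun r => forall x : 'I_?m -> M, @?P r x) =>
      apply (defpred_forall_tuple m P); cbv beta
  | |- defpred (fun r => has_interval (@?P r)) => apply (defpred_has_interval P); cbv beta
  | |- defpred (fun r => @?A r -> @?B r) => apply (defpred_imp A B); cbv beta
  | |- defpred (fun r => lt (@?f r) (@?g r)) => apply (defpred_lt f g); cbv beta
  | |- defpred (fun r => le lt (@?f r) (@?g r)) => apply (defpred_le f g); cbv beta
  | |- defpred (fun r => @eq M (@?f r) (@?g r)) => apply (defpred_eq f g); cbv beta
  | H : def1 ?X |- defpred (fun r => ?X (@?f r)) =>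
      apply (defpred_app1 X f H); cbv beta
  | H : def2 ?X |- defpred (fun r => ?X (@?f r) (@?g r)) =>
      apply (defpred_app2 X f g H); cbv beta
  | H : deffam ?m ?W |- defpred (fun r => ?W (@?F r) (@?w r)) =>
      apply (defpred_appfam m W F w H); cbv beta
  | H : deffam1 ?X |- defpred (fun r => ?X (@?F r) (@?f r)) =>
      apply (defpred_appfam1 X F f H); cbv beta
  | H : defset ?m ?W |- defpred (fun r => ?W (@?w r)) =>
      apply (defpred_appset m W w H); cbv beta
  | H : defpair ?m ?D |- defpred (fun r => ?D (@?w r) (@?f r)) =>
      apply (defpred_apppair m D w f H); cbv beta
  | H : defrel ?m ?R |- defpred (fun r => ?R (@?u r) (@?v r)) =>
      apply (defpred_apprel m R u v H); cbv beta
  | |- defterm (fun _ => ?a) => apply (defterm_const a)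
  | |- defterm (fun r => r ?k) => apply (defterm_var k)
  | |- defterm (fun r => add (@?f r) (@?g r)) => apply (defterm_add f g); cbv beta
  | |- defterm (fun r => opp (@?f r)) => apply (defterm_opp f); cbv beta
  | |- defterm (fun r => scons (@?x r) (@?F r) ?k) =>
      apply (defterm_scons x F k); cbv beta
  | |- defterm (fun r => shift ?m (@?F r) ?k) =>
      apply (defterm_shift F m k); cbv beta
  end.
Ltac dfn := repeat dfn_step.

(** * Definable subsets of the line *)

Context (Hlom : locally_o_minimal lt Def).
Context (Hdc : definably_complete lt Def).

Lemma pts_right a (pts : list M) :
  exists c, a ≺ c /\ forall x, a ≺ x -> x ≺ c -> ~ In x pts.
Proof.
elim: pts => [|y pts [c [ac IH]]]; first by have [c ac] := no_max a; exists c; split=> // x _ _ [].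
case: (classic (a ≺ y)) => ay.
  have [d [ad [dc dy]]] := lt_min _ _ _ ac ay.
  exists d; split=> // x ax xd /= [yx|]; first by subst; ord.
  by apply: IH => //; ord.
exists c; split=> // x ax xc /= [yx|]; first by subst.
exact: IH.
Qed.

Lemma ivs_right a (ivs : list (M * M)) :
  exists c, a ≺ c /\
  ((forall x, a ≺ x -> x ≺ c -> exists pq, In pq ivs /\ pq.1 ≺ x /\ x ≺ pq.2) \/
   (forall x, a ≺ x -> x ≺ c -> ~ exists pq, In pq ivs /\ pq.1 ≺ x /\ x ≺ pq.2)).
Proof.
elim: ivs => [|[p q] ivs [c [ac IH]]].
  by have [c ac] := no_max a; exists c; split=> //; right=> x _ _ [pq []].
case: IH => IH.
  exists c; split=> //; left=> x ax xc.
  by have [pq [? ?]] := IH x ax xc; exists pq; split=> //; right.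
(* Only when p <= a < q does (p, q) contain points immediately to the right of a. *)
case: (classic (p ≼ a)) => pa; case: (classic (a ≺ q)) => aq.
- have [d [ad [dc dq]]] := lt_min _ _ _ ac aq.
  exists d; split=> //; left=> x ax xd; exists (p, q) => /=.
  by split; [left|ord].
- exists c; split=> //; right=> x ax xc [pq [/= [<-|Hin]]] /=.
    by ord.
  by move=> H; apply: (IH x) => //; exists pq.
- have [d [ad [dc dp]]] := lt_min _ _ _ ac (not_le _ _ pa).
  exists d; split=> //; right=> x ax xd [pq [/= [<-|Hin]]] /=.
    by ord.
  by move=> H; apply: (IH x) => //; [ord|exists pq].
- exists c; split=> //; right=> x ax xc [pq [/= [<-|Hin]]] /=.
    by ord.
  by move=> H; apply: (IH x) => //; exists pq.
Qed.

(** Just to the right of a, finitely many points are avoided, and each of finitely many intervals is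
    either entered at once or missed. *)
Lemma germ_right X a : def1 X -> exists c, a ≺ c /\
  ((forall x, a ≺ x -> x ≺ c -> X x) \/ (forall x, a ≺ x -> x ≺ c -> ~ X x)).
Proof.
move=> /def1_Def1 /Hlom /(_ a) [b [c [ba [ac [pts [ivs H]]]]]].
have [c1 [ac1 H1]] := pts_right a pts.
have [c2 [ac2 H2]] := ivs_right a ivs.
have [d [ad [dc1 dc2]]] := lt_min _ _ _ ac1 ac2.
have [e [ae [ed ec]]] := lt_min _ _ _ ad ac.
exists e; split=> //; case: H2 => H2; [left|right] => x ax xe.
  have [|] := H2 x ax; first by ord.
  move=> pq Hpq; case: (H x) => _ [] //; right; by exists pq.
move=> Xx; case: (H x) => [[]]; first by split=> //; ord.
  by move=> Hin _; apply: (H1 x) => //; ord.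
by move=> Hpq _; apply: (H2 x) => //; ord.
Qed.

Lemma oppK x : opp (opp x) = x.
Proof. by rewrite -[LHS]add0r -(addNl x) addA addNl add0l. Qed.

Lemma lt_opp x y : x ≺ y -> opp y ≺ opp x.
Proof.
move=> /(lt_add2l (opp x)) /(lt_add2r (opp y)).
by rewrite addNl add0l -addA addNr add0r.
Qed.

Lemma le_opp x y : x ≼ y -> opp y ≼ opp x.
Proof. by case=> [/lt_opp|->]; [left|right]. Qed.

(** The reflection [opp] exchanges the two sides. *)
Lemma germ_left X a : def1 X -> exists c, c ≺ a /\
  ((forall x, c ≺ x -> x ≺ a -> X x) \/ (forall x, c ≺ x -> x ≺ a -> ~ X x)).
Proof.
move=> dX.
have [|c [ac H]] := germ_right (fun x => X (opp x)) (opp a); first by dfn.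
exists (opp c); split; first by rewrite -(oppK a); exact: lt_opp.
by case: H => H; [left|right] => x cx xa; have := H (opp x) (lt_opp _ _ xa);
  rewrite oppK; apply; rewrite -(oppK c); exact: lt_opp.
Qed.

(** At a point c of the interval the germ of [P] decides: to the right of c, either [P] holds
    throughout, or it fails throughout and [Q] takes over. *)
Lemma has_interval_or P Q : def1 P ->
  has_interval (fun x => P x \/ Q x) -> has_interval P \/ has_interval Q.
Proof.
move=> dP [a [b [ab H]]].
have [c [ac cb]] := dense _ _ ab.
have [d [cd Hd]] := germ_right P c dP.
have [e [ce [ed eb]]] := lt_min _ _ _ cd cb.
case: Hd => Hd; [left|right]; exists c, e; split=> // x cx xe.
  by apply: Hd => //; ord.
have [||Px|//] := H x; [by ord|by ord|].
by case: (Hd x) => //; ord.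
Qed.

Lemma has_interval_restrict (P Q : M -> Prop) :
  def1 Q -> ~ has_interval Q -> has_interval P ->
  has_interval (fun x => P x /\ ~ Q x).
Proof.
move=> dQ sQ iP; case: (has_interval_or Q (fun x => P x /\ ~ Q x)) => //.
by apply: has_interval_sub iP => x Px; case: (classic (Q x)); [left|right].
Qed.

Lemma has_interval_finite (I : eqType) (s : list I) (P : I -> M -> Prop) :
  (forall i, def1 (P i)) -> has_interval (fun x => exists2 i, i \in s & P i x) ->
  exists2 i, i \in s & has_interval (P i).
Proof.
move=> dP; elim: s => [|j s IH] H.
  case: H => a [b [ab H]]; have [c [ac cb]] := dense _ _ ab.
  by have [] := H c.
case: (has_interval_or (P j) (fun x => exists2 i, i \in s & P i x)) => //.
- apply: has_interval_sub H => x [i]; rewrite inE => /orP [/eqP ->|si] Px; first by left.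
  by right; exists i.
- by move=> Hj; exists j; rewrite ?inE ?eqxx.
- by move=> /IH [i si Hi]; exists i; rewrite ?inE ?si ?orbT.
Qed.

(** Neither one-sided germ can lie in [X], so both avoid it. As a is arbitrary, [X] is closed and
    discrete. *)
Lemma small_isolated X a : def1 X -> ~ has_interval X -> exists l r, l ≺ a /\ a ≺ r /\
  forall x, l ≺ x -> x ≺ r -> X x -> x = a.
Proof.
move=> dX sX.
have [r [ar Hr]] := germ_right X a dX.
have [l [la Hl]] := germ_left X a dX.
case: Hr => Hr; first by case: sX; exists a, r.
case: Hl => Hl; first by case: sX; exists l, a.
exists l, r; do 2!split=> //; move=> x lx xr Xx.
case: (lt_total x a) => [xa|[//|ax]]; first by case: (Hl x).
by case: (Hr x).
Qed.

Definition is_inf (X : M -> Prop) s :=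
  (forall x, X x -> s ≼ x) /\ forall b, (forall x, X x -> b ≼ x) -> b ≼ s.
Definition is_sup (X : M -> Prop) s :=
  (forall x, X x -> x ≼ s) /\ forall b, (forall x, X x -> x ≼ b) -> s ≼ b.

Lemma inf_exists X x0 b : def1 X -> X x0 -> (forall x, X x -> b ≼ x) ->
  exists s, is_inf X s.
Proof.
move=> /def1_Def1 /Hdc H Xx0 Hb.
by case: H => [|_ H]; [exists x0|apply: H; exists b].
Qed.

Lemma sup_exists X x0 b : def1 X -> X x0 -> (forall x, X x -> x ≼ b) ->
  exists s, is_sup X s.
Proof.
move=> /def1_Def1 /Hdc H Xx0 Hb.
by case: H => [|H _]; [exists x0|apply: H; exists b].
Qed.

Lemma inf_lt X s t : is_inf X s -> s ≺ t -> exists x, X x /\ s ≼ x /\ x ≺ t.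
Proof.
move=> [H1 H2] st; apply: NNPP => H.
suff : t ≼ s by ord.
apply: H2 => x Xx; apply: NNPP => /not_le xt; apply: H; exists x.
by split=> //; split=> //; exact: H1.
Qed.

Lemma sup_gt X s t : is_sup X s -> t ≺ s -> exists x, X x /\ x ≼ s /\ t ≺ x.
Proof.
move=> [H1 H2] st; apply: NNPP => H.
suff : s ≼ t by ord.
apply: H2 => x Xx; apply: NNPP => /not_le xt; apply: H; exists x.
by split=> //; split=> //; exact: H1.
Qed.

(** The infimum is attained, since near it [X] contains no other point. *)
Lemma small_min X x0 b : def1 X -> ~ has_interval X -> X x0 -> (forall x, X x -> b ≼ x) ->
  exists m, X m /\ forall x, X x -> m ≼ x.
Proof.
move=> dX sX Xx0 Hb; have [s Hs] := inf_exists _ _ _ dX Xx0 Hb.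
have [l [r [ls [sr H]]]] := small_isolated _ s dX sX.
have [x [Xx [sx xr]]] := inf_lt _ _ _ Hs sr.
by exists s; split; [rewrite -(H x) //; ord|case: Hs].
Qed.

(* The set P of minima of the X_t on (c, +oo) accumulates at c, hence contains
   an interval (c, c'), which forces some X_t to contain an interval. *)
Lemma chain_small (X : M -> M -> Prop) : def2 X ->
  (forall t t', (forall x, X t x -> X t' x) \/ (forall x, X t' x -> X t x)) ->
  (forall t, ~ has_interval (X t)) -> ~ has_interval (fun x => exists t, X t x).
Proof.
move=> dX ch sX [c0 [d [c0d H]]].
have [c [c0c cd]] := dense _ _ c0d.
pose P z := c ≺ z /\ exists t, X t z /\ forall z', c ≺ z' -> z' ≺ z -> ~ X t z'.
have dP : def1 P by rewrite /P; dfn.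
have [c1 [cc1 HP]] := germ_right P c dP.
have [c2 [cc2 [c21 c2d]]] := lt_min _ _ _ cc1 cd.
have [z0 [cz0 z0c2]] := dense _ _ cc2.
(* If [P] misses (c, c1), the least point beyond c of an [X t] containing z0 contradicts this. *)
case: HP => HP; last first.
  have [||t Xt] := H z0; [by ord|by ord|].
  have [||||m [[cm Xm] mm]] := small_min (fun z => c ≺ z /\ X t z) z0 c.
  - by dfn.
  - by apply: contra_not (sX t); apply: has_interval_sub => x [].
  - by [].
  - by move=> x [? _]; left.
  have mz0 : m ≼ z0 by exact: mm.
  apply: (HP m) => //; first by ord.
  split=> //; exists t; split=> // z' cz' z'm Xz'.
  have : m ≼ z' by exact: mm.
  by ord.
(* Each z in (z0, c2) is the least point beyond c of some [X t], which therefore omits z0; the chain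
   condition puts [X t] inside [X t1]. *)
have [||t1 Xt1] := H z0; [by ord|by ord|].
apply: (sX t1); exists z0, c2; split=> // z z0z zc2.
have [||cz [t [Xtz Htz]]] := HP z; [by ord|by ord|].
case: (ch t t1) => [/(_ z)|/(_ z0) H1]; first exact.
by case: (Htz z0 cz0 z0z); exact: H1.
Qed.

(** This replaces compactness of [p, q]: the points up to which [G] holds form a segment, and local
    propagation carries it past its supremum. *)
Lemma real_induction G p q : def1 G -> G p -> p ≼ q ->
  (forall c, exists l r, l ≺ c /\ c ≺ r /\
     forall x y, l ≺ x -> x ≼ y -> y ≺ r -> G x -> G y) -> G q.
Proof.
move=> dG Gp pq Hloc.
pose S x := p ≼ x /\ x ≼ q /\ forall y, p ≼ y -> y ≼ x -> G y.
have Sp : S p.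
  split; first by right.
  by split=> // y py yp; have -> : y = p by ord.
have [|||c Hc] := sup_exists S p q.
- by rewrite /S; dfn.
- by [].
- by move=> x [_ []].
have [l [r [lc [cr H]]]] := Hloc c.
have [x [[px [xq Sx]] [xc lx]]] := sup_gt _ _ _ Hc lc.
(* Past the supremum c, [G] persists up to r; unless r exceeds q, this contradicts the choice of
   c. *)
have Hy y : p ≼ y -> y ≺ r -> G y.
  move=> py yr; case: (classic (y ≼ x)) => yx; first exact: Sx.
  apply: (H x y) => //; first by ord.
  by apply: Sx => //; right.
apply: NNPP => nG.
case: (classic (q ≺ r)) => qr; first by apply: nG; exact: Hy.
have [y [cy yr]] := dense _ _ cr.
have : y ≼ c; last by ord.
case: Hc => Hc _; apply: Hc; split; first by ord.
split; first by ord.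
by move=> z pz zy; apply: Hy => //; ord.
Qed.

(** The indices are first confined to [p, q], where [real_induction] on q meets the points of the
    discrete set [E] one at a time; [chain_small] then releases the bounds q and p in turn. *)
Lemma small_union (E : M -> Prop) (X : M -> M -> Prop) : def1 E -> def2 X ->
  ~ has_interval E -> (forall a, E a -> ~ has_interval (X a)) ->
  ~ has_interval (fun x => exists a, E a /\ X a x).
Proof.
move=> dE dX sE sX.
pose Z p q x := exists a, (E a /\ p ≼ a /\ a ≼ q) /\ X a x.
have H1 p q : ~ has_interval (Z p q).
  case: (classic (p ≼ q)) => pq; last first.
    case=> a [b [ab H]]; have [c [ac cb]] := dense _ _ ab.
    by have [d [? _]] := H c ac cb; ord.
  apply: (real_induction (fun q => ~ has_interval (Z p q)) p q) => //.
  - by rewrite /Z; dfn.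
  - case: (classic (E p)) => Ep.
      apply: contra_not (sX p Ep); apply: has_interval_sub => x [a [[Ea pap]]].
      by have -> : a = p by ord.
    case=> a [b [ab H]]; have [c [ac cb]] := dense _ _ ab.
    have [d [[Ed pd] _]] := H c ac cb; apply: Ep.
    by have <- : d = p by ord.
  (* Near c the set [E] has at most the point c, so passing from x to y adds at most the one set
     [X c]. *)
  move=> c; have [l [r [lc [cr H]]]] := small_isolated _ c dE sE.
  exists l, r; do 2!split=> //; move=> x y lx xy yr Gx.
  suff : has_interval (Z p y) -> has_interval (Z p x) \/ (E c /\ has_interval (X c)).
    by move=> + /[dup] => /[apply] -[//|[Ec Xc]] _; case: (sX c Ec).
  case: (classic (E c)) => Ec HZ.
    case: (has_interval_or (Z p x) (X c)); first by rewrite /Z; dfn.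
    - apply: has_interval_sub HZ => z [a [[Ea [pa ay]] Xa]].
      case: (classic (a ≼ x)) => ax; first by left; exists a.
      by right; rewrite -(H a) //; ord.
    - by left.
    - by right.
  left; apply: has_interval_sub HZ => z [a [[Ea [pa ay]] Xa]].
  exists a; do 2!split=> //; split=> //; apply: NNPP => ax; apply: Ec.
  by rewrite -(H a) //; ord.
have H2 p : ~ has_interval (fun x => exists q, Z p q x).
  apply: chain_small => //; first by rewrite /Z; dfn.
  move=> q q'; case: (classic (q ≼ q')) => qq; [left|right] => x;
    by move=> [a [[Ea [pa aq]] Xa]]; exists a; do 2!split=> //; split=> //; ord.
have : ~ has_interval (fun x => exists p q, Z p q x).
  apply: chain_small => //; first by rewrite /Z; dfn.
  move=> q q'; case: (classic (q ≼ q')) => qq; [right|left] => x;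
    by move=> [e [a [[Ea [pa aq]] Xa]]]; exists e, a; do 2!split=> //; split=> //; ord.
apply: contra_not; apply: has_interval_sub => x [a [Ea Xa]].
by exists a, a, a; split=> //; do 2!split=> //; right.
Qed.

(** This makes a monotone parameter, such as a length or a bound, uniform over an interval. *)
Lemma chain_has_interval (X : M -> M -> Prop) : def2 X ->
  (forall t t', (forall x, X t x -> X t' x) \/ (forall x, X t' x -> X t x)) ->
  has_interval (fun x => exists t, X t x) -> exists t, has_interval (X t).
Proof.
move=> dX ch H; apply: NNPP => nX; apply: (chain_small X dX ch) => // t Ht.
by apply: nX; exists t.
Qed.

Lemma has_interval_ex (P : M -> Prop) : has_interval P -> exists x, P x.
Proof.
by move=> [a [b [/dense [c [ac cb]] H]]]; exists c; exact: H.
Qed.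

(* After bounding the location of an interval contained in X_x and its length e
   from below, uniformly for x in an interval, its left endpoint can be confined
   to a segment shorter than e. *)
Lemma has_interval_swap (X : M -> M -> Prop) : def2 X ->
  has_interval (fun x => has_interval (X x)) ->
  has_interval (fun y => has_interval (fun x => X x y)).
Proof.
move=> dX H0.
pose B e a x := forall y, a ≺ y -> y ≺ add a e -> X x y.
have [|||e He] := chain_has_interval (fun e x => zero ≺ e /\ exists a, B e a x).
- by rewrite /B; dfn.
- move=> e e'; case: (classic (zero ≺ e)) => [pe|]; last by left=> x [].
  case: (classic (zero ≺ e')) => [pe'|]; last by right=> x [].
  case: (classic (e ≼ e')) => ee; [right|left];
    move=> x [e0 [a H]]; split=> //; exists a => y ay ye;
    apply: H => //; apply: lt_le_trans ye _; apply: le_add2l; ord.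
- apply: has_interval_sub H0 => x [a [b [ab H]]].
  exists (add (opp a) b); split; first by rewrite -(addNl a); exact: lt_add2l.
  by exists a; rewrite /B addA addNr add0l.
have e0 : zero ≺ e by have [x []] := has_interval_ex _ He.
have {}He : has_interval (fun x => exists a, B e a x) by apply: has_interval_sub He => x [].
have [|||q Hq] := chain_has_interval (fun q x => exists a, a ≼ q /\ B e a x).
- by rewrite /B; dfn.
- move=> q q'; case: (classic (q ≼ q')) => qq; [left|right];
    by move=> x [a [aq Ha]]; exists a; split=> //; ord.
- by apply: has_interval_sub He => x [a Ha]; exists a, a; split=> //; exact: le_refl.
have [|||p Hp] := chain_has_interval (fun p x => exists a, p ≼ a /\ a ≼ q /\ B e a x).
- by rewrite /B; dfn.
- move=> p p'; case: (classic (p ≼ p')) => pp; [right|left];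
    by move=> x [a [pa Ha]]; exists a; split=> //; ord.
- by apply: has_interval_sub Hq => x [a Ha]; exists a, a; split=> //; exact: le_refl.
pose Y c x := exists a, p ≼ a /\ a ≼ c /\ B e a x.
have dY : def2 Y by rewrite /Y /B; dfn.
have [|||c0 Hc0] := inf_exists (fun c => has_interval (Y c)) q p.
- by dfn.
- by [].
- by move=> c /has_interval_ex [x [a [pa [ac _]]]]; ord.
(* For x in [Y c1] but not in [Y c2], the left endpoint a satisfies c2 < a <= c1, so (a, a + e)
   contains (c1, c2 + e). These x fill an interval because c2 lies below the infimum c0. *)
have [c2 [c02 c20]] : exists c2, add c0 (opp e) ≺ c2 /\ c2 ≺ c0.
  apply: dense; rewrite -{2}(add0r c0); apply: lt_add2l.
  by have := lt_add2r (opp e) _ _ e0; rewrite add0l addNr.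
have {}c02 : c0 ≺ add c2 e.
  by move: (lt_add2r e _ _ c02); rewrite -addA addNl add0r.
have [c1 [Hc1 [_ c1e]]] := inf_lt _ _ _ Hc0 c02.
have Hc2 : ~ has_interval (Y c2) by move=> /(proj1 Hc0); ord.
exists c1, (add c2 e); split=> // y c1y yc2.
have : has_interval (fun x => Y c1 x /\ ~ Y c2 x) by apply: has_interval_restrict => //; dfn.
apply: has_interval_sub => x [[a [pa [ac1 Ha]]] nY].
apply: (Ha); first by ord.
apply: lt_trans yc2 _; apply: lt_add2r; apply: NNPP => /not_lt ac2.
by apply: nY; exists a.
Qed.

(** * Dimension *)

(* fat js W says that W has dimension at least the length of js, as witnessed
   by its projection to the coordinates js. *)
Fixpoint fatq m (js : list 'I_m) (W : ('I_m -> M) -> Prop)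
    (Phi : (('I_m -> M) -> Prop) -> Prop) : Prop :=
  match js with
  | nil => Phi W
  | cons j js => has_interval (fun y => fatq m js (fun w => W w /\ w j = y) Phi)
  end.

(** Requiring nonempty fibres gives the dimension; other choices of [Phi] in [fatq] retain
    information about the fibre itself. *)
Definition fat m js W := fatq m js W (fun W' => exists w, W' w).

Lemma fat_mono m js (W W' : ('I_m -> M) -> Prop) :
  (forall w, W w -> W' w) -> fat m js W -> fat m js W'.
Proof.
elim: js W W' => [|j js IH] W W' WW' /=; first by move=> [w /WW' ?]; exists w.
by apply: has_interval_sub => y; apply: IH => w [/WW'].
Qed.

Lemma fatq_mono m js (W : ('I_m -> M) -> Prop) Phi Psi : defset m W ->
  (forall W', defset m W' -> (forall w, W' w -> W w) -> Phi W' -> Psi W') ->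
  fatq m js W Phi -> fatq m js W Psi.
Proof.
elim: js W => [|j js IH] W dW H /=; first exact: H.
apply: has_interval_sub => y; apply: IH; first by dfn.
by move=> W' dW' WW'; apply: H => // w /WW' [].
Qed.

Lemma defpred_fat m js (W : (nat -> M) -> ('I_m -> M) -> Prop) :
  deffam m W -> defpred (fun r => fat m js (W r)).
Proof.
elim: js W => [|j js IH] W dW; first by rewrite /fat /=; dfn.
apply: defpred_has_interval.
by apply: (IH (fun r w => W (shift 1 r) w /\ w j = r 0)); dfn.
Qed.

(** By [has_interval_swap], the interval of x moves inwards past each coordinate of [js]. *)
Lemma fat_swap m js (W : ('I_m -> M) -> Prop) D : defset m W -> defpair m D ->
  has_interval (fun x => fat m js (fun w => W w /\ D w x)) ->
  fatq m js W (fun W' => has_interval (fun x => exists w, W' w /\ D w x)).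
Proof.
elim: js W => [|j js IH] W dW dD //= H.
have {}H : has_interval (fun y => has_interval (fun x =>
    fat m js (fun w => (W w /\ D w x) /\ w j = y))).
  apply: (has_interval_swap (fun x y => fat m js (fun w => (W w /\ D w x) /\ w j = y))) => //.
  by apply: (defpred_fat _ _
    (fun r w => (W w /\ D w (r 0)) /\ w j = r 1)); dfn.
apply: has_interval_sub H => y H; apply: IH => //; first by dfn.
by apply: has_interval_sub H => x; apply: fat_mono => w; tauto.
Qed.

(** The extra coordinate may vary with the fibre, but there are finitely many candidates, so
    [has_interval_finite] makes it uniform at each stage. *)
Lemma fatq_rcons m js (W : ('I_m -> M) -> Prop) : defset m W ->
  fatq m js W (fun W' => exists j, has_interval (fun y => exists w, W' w /\ w j = y)) ->
  exists j, fat m (js ++ [:: j]) W.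
Proof.
elim: js W => [|i js IH] W dW //= H.
have [||j _ Hj] := has_interval_finite _ (enum 'I_m)
  (fun j y => fat m (js ++ [:: j]) (fun w => W w /\ w i = y)).
- move=> j; apply: (defpred_fat _ _ (fun r w => W w /\ w i = r 0)); dfn.
- apply: has_interval_sub H => y /IH [|j Hj]; first by dfn.
  by exists j => //; rewrite mem_enum.
by exists j.
Qed.

Lemma fat_ex m js (W : ('I_m -> M) -> Prop) : fat m js W -> exists w, W w.
Proof.
elim: js W => [//|j js IH] W /= /has_interval_ex [y /IH [w [Ww _]]].
by exists w.
Qed.

(** A coordinate once fixed cannot sweep an interval again. Hence [js] has distinct entries in
    [fat_uniq], and the dimension is at most m. *)
Lemma fat_fixed m js (W : ('I_m -> M) -> Prop) j c : j \in js ->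
  (forall w, W w -> w j = c) -> ~ fat m js W.
Proof.
elim: js W => [//|i js IH] W; rewrite inE => + HW /=.
case: (boolP (j \in js)) => [jjs _ /has_interval_ex [y]|_].
  by apply: IH => // w [/HW].
rewrite orbF => /eqP <- [a [b [ab H]]].
have [x [ax xb]] := dense _ _ ab; have [z [az zx]] := dense _ _ ax.
have E y : a ≺ y -> y ≺ b -> y = c.
  by move=> /H /[apply] /fat_ex [w [/HW ? <-]].
have Ex := E x ax xb; have Ez : z = c by apply: E => //; ord.
by ord.
Qed.

Lemma fat_uniq m js (W : ('I_m -> M) -> Prop) : fat m js W -> uniq js.
Proof.
elim: js W => [//|j js IH] W /= /has_interval_ex [y H]; rewrite (IH _ H) andbT.
by apply/negP => jjs; apply: (fat_fixed _ _ _ _ y jjs _ H) => w [].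
Qed.

(** Slicing [W] along the coordinates of [js] one by one reduces this to [small_union]; when none is
    left, [W] has at most one element. *)
Lemma small_tuple_union m (js : list 'I_m) (W : ('I_m -> M) -> Prop) D :
  defset m W -> defpair m D -> (forall w, W w -> ~ has_interval (D w)) ->
  (forall j, ~ has_interval (fun y => exists w, W w /\ w j = y)) ->
  (forall w w', W w -> W w' -> (forall i, i \in js -> w i = w' i) -> w = w') ->
  ~ has_interval (fun x => exists w, W w /\ D w x).
Proof.
elim: js W => [|j js IH] W dW dD sD sW uW.
  move=> H; have [x [w [Ww _]]] := has_interval_ex _ H; apply: (sD w Ww).
  by apply: has_interval_sub H => y [w' [Ww']]; rewrite (uW w w').
have := small_union (fun y => exists w, W w /\ w j = y)
  (fun y x => exists w, (W w /\ w j = y) /\ D w x).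
move=> H; apply: contra_not (H _ _ _ _).
- apply: has_interval_sub => x [w [Ww Dwx]]; exists (w j); split; first by exists w.
  by exists w.
- by dfn.
- by dfn.
- exact: sW.
move=> a _; apply: IH => //; first by dfn.
- by move=> w [/sD].
- by move=> i; apply: contra_not (sW i); apply: has_interval_sub => y [w [[? _] ?]]; exists w.
move=> w w' [Ww wa] [Ww' wa'] E; apply: uW => // i; rewrite inE => /orP [/eqP ->|]; last exact: E.
by rewrite wa wa'.
Qed.

(* A definable family of sets without interior, indexed by W of dimension < e,
   cannot cover all finite subsets of an interval: each point added to a
   finite set can be chosen so as to lower the dimension of the set of indices. *)
Lemma finite_escape m e (W : ('I_m -> M) -> Prop) D a b :
  defset m W -> defpair m D -> (forall js, size js = e -> ~ fat m js W) ->
  (forall w, W w -> ~ has_interval (D w)) -> a ≺ b ->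
  exists l : list M, (forall x, In x l -> a ≺ x /\ x ≺ b) /\
    forall w, W w -> exists x, In x l /\ ~ D w x.
Proof.
move=> + dD + + ab; elim: e W => [|e IH] W dW nW sD.
  (* For e = 0 the empty list of coordinates shows that [W] is empty. *)
  exists [::]; split=> // w Ww.
  by case: (nW [::]) => //; exists w.
(* Otherwise one [js] of length e works for an interval of x, and [fat_swap] yields fibres W' over
   which the sets [D w] jointly cover an interval. *)
have [x [ax [xb Hx]]] : exists x, a ≺ x /\ x ≺ b /\
    forall js, size js = e -> ~ fat m js (fun w => W w /\ D w x).
  apply: NNPP => Hn.
  have [||js _ Hjs] := has_interval_finite _ (enum {: e.-tuple 'I_m})
    (fun js x => fat m js (fun w => W w /\ D w x)).
  - move=> js; apply: (defpred_fat _ _ (fun r w => W w /\ D w (r 0))); dfn.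
  - exists a, b; split=> // x ax xb; apply: NNPP => Hx; apply: Hn; exists x.
    do 2!split=> //; move=> js /eqP sjs Hb; apply: Hx.
    by exists (Tuple sjs) => //; rewrite mem_enum.
  have {}Hjs := fat_swap _ _ _ _ dW dD Hjs.
  have [|j] := fatq_rcons m js W dW; last first.
    by apply: nW; rewrite size_cat size_tuple addn1.
  (* If every coordinate took a small set of values on W', the union would be small; so some
     coordinate extends [js] to length e + 1. *)
  apply: fatq_mono Hjs => // W' dW' WW' HI; apply: NNPP => Hn'.
  apply: (small_tuple_union _ (enum 'I_m) _ _ dW' dD) HI.
  - by move=> w /WW' /sD.
  - by move=> j Hj; apply: Hn'; exists j.
  - move=> w w' _ _ E; apply: functional_extensionality => i.
    by apply: E; rewrite mem_enum.
have [|||l [Hl1 Hl2]] := IH (fun w => W w /\ D w x).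
- by dfn.
- exact: Hx.
- by move=> w [/sD].
exists (x :: l); split=> [z /= [<-//|/Hl1 //]|w Ww].
case: (classic (D w x)) => Dwx; last by exists x; split=> //; left.
by have [|z [zl Dz]] := Hl2 w; [|exists z; split=> //; right].
Qed.

(** * Definable choice *)

Lemma is_inf_uniq X s s' : is_inf X s -> is_inf X s' -> s = s'.
Proof. by move=> [H1 H2] [H1' H2']; apply: le_anti; [apply: H2'|apply: H2]. Qed.

Lemma is_sup_uniq X s s' : is_sup X s -> is_sup X s' -> s = s'.
Proof. by move=> [H1 H2] [H1' H2']; apply: le_anti; [apply: H2|apply: H2']. Qed.

(** The cap [e] keeps the supremum of such x finite when [Z] contains everything beyond r. Doubling
    x avoids dividing by two. *)
Definition half_gap (e : M) (Z : M -> Prop) (r x : M) :=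
  x ≼ e /\ forall z, r ≺ z -> z ≺ add r (add x x) -> Z z.

(* When the infimum r of Z is not attained, a point of Z is found strictly
   inside an interval (r, r + 2h) contained in Z. *)
Definition select_nonneg (e : M) (Z : M -> Prop) (y : M) :=
  exists r, is_inf Z r /\
    ((Z r /\ y = r) \/ (~ Z r /\ exists h, is_sup (half_gap e Z r) h /\ y = add r h)).

Lemma select_nonneg_uniq e Z y y' :
  select_nonneg e Z y -> select_nonneg e Z y' -> y = y'.
Proof.
move=> [r [Hr H]] [r' [Hr' H']].
have rr' := is_inf_uniq _ _ _ Hr Hr'; subst r'.
case: H H' => [[Zr ->]|[nZ [h [Hh ->]]]] [[Zr' ->]|[nZ' [h' [Hh' ->]]]] //.
by rewrite (is_sup_uniq _ _ _ Hh Hh').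
Qed.

Lemma select_nonneg_ex e Z : zero ≺ e -> def1 Z -> (forall x, Z x -> zero ≼ x) ->
  (exists x, Z x) -> exists y, select_nonneg e Z y /\ Z y.
Proof.
move=> e0 dZ Z0 [x0 Zx0].
have [r Hr] := inf_exists _ _ _ dZ Zx0 Z0.
case: (classic (Z r)) => Zr; first by exists r; split=> //; exists r; split=> //; left.
have [c [rc Hc]] := germ_right Z r dZ.
case: Hc => Hc; last first.
  have [x [Zx [rx xc]]] := inf_lt _ _ _ Hr rc.
  case: rx => [rx|rx]; first by case: (Hc x).
  by subst x.
pose d := add (opp r) c.
have d0 : zero ≺ d by rewrite -(addNl r); exact: lt_add2l.
have [z [z0 zd]] := dense _ _ d0.
have z'0 : zero ≺ add (opp z) d by rewrite -(addNl z); exact: lt_add2l.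
(* As d is the sum of z and [add (opp z) d], an x2 exceeding neither satisfies r + 2 x2 <= c. *)
have [x1 [x10 [x1z x1z']]] := lt_min _ _ _ z0 z'0.
have [x2 [x20 [x21 x2e]]] := lt_min _ _ _ x10 e0.
have Hx2 : half_gap e Z r x2.
  split=> // y ry yx; apply: Hc => //; apply: lt_le_trans yx _.
  have -> : c = add r (add z (add (opp z) d)).
    by rewrite [add z _]addA addNr add0l /d addA addNr add0l.
  apply: le_add2l; apply: le_trans (le_add2l _ _ _ _) (le_add2r _ _ _ _); ord.
have [|||h Hh] := sup_exists (half_gap e Z r) x2 e.
- by rewrite /half_gap; dfn.
- by [].
- by move=> x [].
exists (add r h); split.
  by exists r; split=> //; right; split=> //; exists h.
have x2h : x2 ≼ h by case: Hh => Hh _; exact: Hh.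
(* The supremum h may lie outside [half_gap], but an x in it with h < x + x2 <= 2x places r + h
   inside (r, r + 2x). *)
have [x [[xe Hx] [xh x2x hx]]] : exists x, half_gap e Z r x /\
    [/\ x ≼ h, x2 ≼ x & h ≺ add x x2].
  have lt_h : add h (opp x2) ≺ h.
    rewrite -{2}(add0r h); apply: lt_add2l.
    by have := lt_add2r (opp x2) _ _ x20; rewrite add0l addNr.
  have [x [Hx [xh hx]]] := sup_gt _ _ _ Hh lt_h.
  have {}hx : h ≺ add x x2.
    by have := lt_add2r x2 _ _ hx; rewrite -addA addNl add0r.
  case: (classic (x2 ≼ x)) => x2x; first by exists x.
  exists x2; split=> //; split=> //; first by right.
  by apply: lt_trans hx _; apply: lt_add2r; ord.
apply: Hx.
  by rewrite -{1}(add0r r); apply: lt_add2l; ord.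
apply: lt_add2l; apply: lt_le_trans hx _; exact: le_add2l.
Qed.

(** The nonnegative part is bounded below, so [select_nonneg] applies to it; if it is empty, the
    reflected negative part is used. *)
Lemma choice1 X : deffam1 X -> exists Y, deffam1 Y /\
  (forall r y, Y r y -> X r y) /\
  (forall r, (exists y, X r y) -> exists y, Y r y) /\
  (forall r y y', Y r y -> Y r y' -> y = y').
Proof.
move=> dX; have [e e0] := no_max zero.
pose Zp r x := zero ≼ x /\ X r x.
pose Zn r x := zero ≼ x /\ X r (opp x).
pose Y r y := ((exists x, Zp r x) /\ select_nonneg e (Zp r) y) \/
  (~ (exists x, Zp r x) /\ (exists x, Zn r x) /\ select_nonneg e (Zn r) (opp y)).
have Hp r : (exists x, Zp r x) -> exists y, select_nonneg e (Zp r) y /\ Zp r y.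
  by apply: select_nonneg_ex => //; [rewrite /Zp; dfn|move=> x []].
have Hn r : (exists x, Zn r x) -> exists y, select_nonneg e (Zn r) y /\ Zn r y.
  by apply: select_nonneg_ex => //; [rewrite /Zn; dfn|move=> x []].
exists Y; split; last split; last split.
- by rewrite /Y /select_nonneg /is_inf /is_sup /half_gap /Zp /Zn; dfn.
- move=> r y [[/Hp [y' [Hy' [_ Zy']]] Hy]|[_ [/Hn [y' [Hy' [_ Zy']]] Hy]]].
    by rewrite (select_nonneg_uniq _ _ _ _ Hy Hy').
  by rewrite -(oppK y) (select_nonneg_uniq _ _ _ _ Hy Hy').
- move=> r [y Xy]; case: (classic (exists x, Zp r x)) => Hx.
    by have [z [Hz _]] := Hp r Hx; exists z; left.
  have Hx' : exists x, Zn r x.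
    exists (opp y); split; rewrite ?oppK //.
    apply: NNPP => /not_le H; apply: Hx; exists y; split=> //.
    by left; have := lt_add2l y _ _ H; rewrite addNr add0r.
  have [z [Hz _]] := Hn r Hx'.
  by exists (opp z); right; do 2!split=> //; rewrite oppK.
- move=> r y y' [[H Hy]|[H [_ Hy]]] [[H' Hy']|[H' [_ Hy']]] //.
    exact: select_nonneg_uniq Hy Hy'.
  by rewrite -(oppK y) (select_nonneg_uniq _ _ _ _ Hy Hy') oppK.
Qed.

(** The coordinates are chosen one after another, each choice shrinking the fibres for the next. *)
Lemma choice_tuple m (js : list 'I_m) X : deffam m X -> exists Y, deffam m Y /\
  (forall r u, Y r u -> X r u) /\
  (forall r, (exists u, X r u) -> exists u, Y r u) /\
  (forall r u u' j, Y r u -> Y r u' -> j \in js -> u j = u' j).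
Proof.
elim: js X => [|j js IH] X dX; first by exists X.
have [|Y1 [dY1 [sY1 [eY1 uY1]]]] :=
  choice1 (fun r y => exists u, X r u /\ u j = y); first by dfn.
have [|Y [dY [sY [eY uY]]]] := IH (fun r u => X r u /\ Y1 r (u j)); first by dfn.
exists Y; do 2!split=> //; first by move=> r u /sY [].
split.
  move=> r [u Xu]; apply: eY.
  have [|y Yy] := eY1 r; first by exists (u j), u.
  by have [u' [Xu' eu]] := sY1 _ _ Yy; exists u'; rewrite eu.
move=> r u u' i Yu Yu'; rewrite inE => /orP [/eqP ->|ijs]; last exact: uY Yu Yu' ijs.
have [_ H] := sY _ _ Yu; have [_ H'] := sY _ _ Yu'; exact: uY1 H H'.
Qed.

(** * Exhausting a directed set *)

Context (n : nat) (Omega : ('I_n -> M) -> Prop).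
Context (pre : ('I_n -> M) -> ('I_n -> M) -> Prop).
Context (Hdir : definable_directed_set Def Omega pre).

Lemma defset_Omega : defset n Omega.
Proof. by case: Hdir => dO _; exists n, Omega. Qed.

Lemma defrel_pre : defrel n pre.
Proof. by case: Hdir => _ [dP _]; exists (n + n); eexists; split; first exact: dP. Qed.

Definition bounded (K : ('I_n -> M) -> Prop) :=
  exists w, Omega w /\ forall u, K u -> pre w u.

Lemma bounded_sub (K K' : ('I_n -> M) -> Prop) :
  (forall u, K u -> K' u) -> bounded K' -> bounded K.
Proof. by move=> KK' [w [Ow H]]; exists w; split=> // u /KK' /H. Qed.

Lemma bounded_or (K K' : ('I_n -> M) -> Prop) : (forall u, K u -> Omega u) ->
  (forall u, K' u -> Omega u) ->
  bounded K -> bounded K' -> bounded (fun u => K u \/ K' u).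
Proof.
move=> KO KO' [w [Ow H]] [w' [Ow' H']].
have [_ [_ [_ [tr [_ dir]]]]] := Hdir.
have [|v [Ov Hv]] := dir [:: w; w']; first by move=> u /= [<-|[<-|//]].
exists v; split=> // u [Ku|Ku].
  by apply: (tr _ w) => //; [exact: KO|apply: Hv; left|exact: H].
by apply: (tr _ w') => //; [exact: KO'|apply: Hv; right; left|exact: H'].
Qed.

Lemma bounded0 (K : ('I_n -> M) -> Prop) : (forall u, ~ K u) -> bounded K.
Proof.
have [_ [_ [_ [_ [[w Ow] _]]]]] := Hdir.
by move=> nK; exists w; split=> // u /nK.
Qed.

Lemma bounded_list (I : Type) (l : list I) (K : I -> ('I_n -> M) -> Prop) :
  (forall i u, K i u -> Omega u) -> (forall i, In i l -> bounded (K i)) ->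
  bounded (fun u => exists i, In i l /\ K i u).
Proof.
move=> KO; elim: l => [|i l IH] H; first by apply: bounded0 => u [j []].
apply: (bounded_sub _ (fun u => K i u \/ exists j, In j l /\ K j u)).
  by move=> u [j [/= [<-|jl] Kj]]; [left|right; exists j].
apply: bounded_or; first exact: KO.
- by move=> u [j [_ /KO]].
- by apply: H; left.
- by apply: IH => j jl; apply: H; right.
Qed.

(* Every finite subset of an interval lies in the set of those a for which some
   w bounds L_a, so by finite_escape one of these sets has interior. *)
Lemma bad_small (L : ('I_n -> M) -> M -> Prop) (j : 'I_n) :
  defpair n L ->
  (forall a u, L u a -> Omega u /\ u j = a) -> (forall a, bounded (fun u => L u a)) ->
  ~ has_interval (fun b => forall l r, l ≺ b -> b ≺ r ->
           ~ bounded (fun u => l ≺ u j /\ u j ≺ r /\ L u (u j))).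
Proof.
move=> dL LO Lb [a0 [b0 [ab H]]].
have dO := defset_Omega; have dP := defrel_pre.
pose D w a := a0 ≺ a /\ a ≺ b0 /\ forall u, L u a -> pre w u.
(* No list of n + 1 coordinates is free of repetitions, so [Omega] has dimension below n + 1. *)
have [|||||l [Hl1 Hl2]] := finite_escape n n.+1 Omega D a0 b0.
- exact: dO.
- by rewrite /D; dfn.
- move=> js sz /fat_uniq /card_uniqP ujs.
  by have := max_card (mem js); rewrite ujs sz card_ord ltnn.
(* If [D w] contained (c, d), then w would bound the union over (c, d), and no point of (c, d) would
   be bad. *)
- move=> w Ow [c [d [cd HD]]].
  have [z [cz zd]] := dense _ _ cd; have [a0z [zb0 _]] := HD z cz zd.
  apply: (H z a0z zb0 c d) => //; exists w; split=> // u [cu [ud Lu]].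
  by have [_ [_]] := HD _ cu ud; exact.
- exact: ab.
have [||w [Ow Hw]] := bounded_list _ l (fun a u => L u a).
- by move=> a u /LO [].
- by move=> a _; exact: Lb.
have [x [xl nD]] := Hl2 w Ow; apply: nD.
have [ax xb] := Hl1 x xl; do 2!split=> //.
by move=> u Lu; apply: Hw; exists x.
Qed.

(** By directedness, boundedness on [p, x] extends across a neighbourhood of c with the local bound
    there, so [real_induction] applies. *)
Lemma compact_bounded (L : ('I_n -> M) -> M -> Prop) (j : 'I_n) p q :
  defpair n L ->
  (forall a u, L u a -> Omega u /\ u j = a) -> (forall a, bounded (fun u => L u a)) ->
  (forall c, exists l r, l ≺ c /\ c ≺ r /\
     bounded (fun u => l ≺ u j /\ u j ≺ r /\ L u (u j))) ->
  p ≼ q -> bounded (fun u => p ≼ u j /\ u j ≼ q /\ L u (u j)).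
Proof.
move=> dL LO Lb Hloc pq.
have dO := defset_Omega; have dP := defrel_pre.
apply: (real_induction
  (fun q => bounded (fun u => p ≼ u j /\ u j ≼ q /\ L u (u j))) p q) => //.
- by rewrite /bounded; dfn.
- apply: bounded_sub (Lb p) => u [pu [up Lu]].
  by have <- : u j = p by ord.
move=> c; have [l [r [lc [cr Hc]]]] := Hloc c.
exists l, r; do 2!split=> //; move=> x y lx xy yr Gx.
apply: bounded_sub (bounded_or _ _ _ _ Gx Hc) => [u [pu [uy Lu]]|u|u].
- case: (classic (u j ≼ x)) => ux; [by left|right].
  by split; [ord|split=> //; ord].
- by move=> [_ [_ /LO []]].
- by move=> [_ [_ /LO []]].
Qed.

Definition env_st s t (r : nat -> M) := scons s (scons t r).

(** The parameters r are carried along so that the induction hypothesis exhausts all fibres u j = a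
    at once, definably in a. *)
Lemma exhaustion (js : list 'I_n) X : deffam n X ->
  (forall r u, X r u -> Omega u) ->
  (forall r u u', X r u -> X r u' -> (forall j, j \in js -> u j = u' j) -> u = u') ->
  exists K, deffam n K /\
    (forall s t r u, K (env_st s t r) u -> X r u) /\
    (forall s t r, zero ≺ s -> zero ≺ t -> bounded (K (env_st s t r))) /\
    (forall s t s' t' r u, s' ≼ s -> t ≼ t' ->
       K (env_st s t r) u -> K (env_st s' t' r) u) /\
    (forall r u, X r u -> exists s t, zero ≺ s /\ zero ≺ t /\ K (env_st s t r) u).
Proof.
elim: js X => [|j js IH] X dX XO uX.
  (* [X r] has at most one element, which bounds itself by reflexivity; [shift 2] discards s and
     t. *)
  exists (fun r => X (shift 2 r)); split; first by dfn.
  do 2!split=> //.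
    move=> s t r _ _; case: (classic (exists u, X r u)) => [[u Xu]|nX].
      have [_ [_ [rfl _]]] := Hdir.
      exists u; split; first exact: XO Xu.
      by move=> u' Xu'; rewrite (uX r u' u) //; apply: rfl; exact: XO Xu.
    by apply: bounded0 => u Xu; apply: nX; exists u.
  split=> // r u Xu; have [s s0] := no_max zero.
  by exists s, s.
have [|||K [dK [KX [Kb [Km Ke]]]]] :=
  IH (fun r u => X (shift 1 r) u /\ u j = r 0).
- by dfn.
- by move=> r u [/XO].
- move=> r u u' [Xu eu] [Xu' eu'] E; apply: uX Xu Xu' _ => i.
  by rewrite inE => /orP [/eqP ->|/E //]; rewrite eu eu'.
have dO := defset_Omega; have dP := defrel_pre.
pose L s t r a := K (env_st s t (scons a r)).
have LX s t r a u : L s t r a u -> X r u /\ u j = a by exact: KX.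
have LO s t r a u : L s t r a u -> Omega u /\ u j = a by move=> /LX [/XO].
pose bad r s t b := forall l r', l ≺ b -> b ≺ r' ->
  ~ bounded (fun u => l ≺ u j /\ u j ≺ r' /\ L s t r (u j) u).
pose B r b := exists t, zero ≺ t /\ exists s, zero ≺ s /\ bad r s t b.
(* The two inequalities say that a and b are within s of each other. *)
pose C r s a := forall b, B r b -> b ≺ add a s -> a ≺ add b s -> a = b.
have dL s t r : defpair n (fun u a => L s t r a u).
  by rewrite /L /env_st; dfn.
have Bsmall r : ~ has_interval (B r).
  have bad_mono s t s' t' b : s' ≼ s -> t ≼ t' -> bad r s t b -> bad r s' t' b.
    move=> ss tt H l r' lb br; apply: contra_not (H l r' lb br).
    by apply: bounded_sub => u [lu [ur Lu]]; do 2!split=> //; exact: Km Lu.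
  apply: chain_small.
  - by rewrite /bad /bounded /L /env_st; dfn.
  (* A nonpositive t gives the empty set, which is comparable with every other. *)
  - move=> t t'; case: (classic (zero ≺ t)) => [t0|]; last by left=> x [].
    case: (classic (zero ≺ t')) => [t'0|]; last by right=> x [].
    case: (classic (t ≼ t')) => tt; [left|right];
      move=> x [_ [s [s0 Hb]]]; split=> //; exists s; split=> //;
      apply: bad_mono Hb; try (exact: le_refl); ord.
  move=> t Ht; have t0 : zero ≺ t by have [x []] := has_interval_ex _ Ht.
  have : has_interval (fun x => exists s, zero ≺ s /\ bad r s t x).
    by apply: has_interval_sub Ht => x [].
  apply: chain_small.
  - by rewrite /bad /bounded /L /env_st; dfn.
  - move=> s s'; case: (classic (zero ≺ s)) => [s0|]; last by left=> x [].
    case: (classic (zero ≺ s')) => [s'0|]; last by right=> x [].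
    case: (classic (s' ≼ s)) => ss; [left|right];
      move=> x [_ Hb]; split=> //;
      apply: bad_mono Hb; try (exact: le_refl); ord.
  move=> s Hs; have s0 : zero ≺ s by have [x []] := has_interval_ex _ Hs.
  apply: (bad_small (fun u a => L s t r a u) j (dL s t r)).
  - by move=> a u; exact: LO.
  - by move=> a; exact: Kb.
  - by apply: has_interval_sub Hs => x [].
exists (fun e u => L (e 0) (e 1) (shift 2 e) (u j) u /\ opp (e 1) ≼ u j /\
  u j ≼ e 1 /\ C (shift 2 e) (e 0) (u j)).
split; first by rewrite /C /B /bad /bounded /L /env_st; dfn.
split; first by move=> s t r u [/LX []].
split.
  move=> s t r s0 t0.
  apply: (bounded_sub _ (fun u => opp t ≼ u j /\ u j ≼ t /\
            (C r s (u j) /\ L s t r (u j) u))).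
    by move=> u [Lu [tu [ut Cu]]].
  apply: (compact_bounded (fun u a => C r s a /\ L s t r a u)).
  - by rewrite /C /B /bad /bounded /L /env_st; dfn.
  - by move=> a u [_ /LO].
  - by move=> a; apply: bounded_sub (Kb s t (scons a r) s0 t0) => u [].
  (* A point that is not bad has a suitable neighbourhood by definition. Around a bad c, condition
     [C] leaves only a = c within s, and the fibre over c is bounded. *)
  - move=> c; case: (classic (bad r s t c)) => Hbad; last first.
      apply: NNPP => Hn; apply: Hbad => l r' lc cr Hb; apply: Hn.
      exists l, r'; do 2!split=> //; apply: bounded_sub Hb => u [? [? [_ ?]]].
      by [].
    have Bc : B r c by exists t; split=> //; exists s.
    exists (add c (opp s)), (add c s); split; last split.
    + have := lt_add2l c _ _ (lt_add2r (opp s) _ _ s0).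
      by rewrite add0l addNr add0r.
    + by have := lt_add2l c _ _ s0; rewrite add0r.
    apply: bounded_sub (Kb s t (scons c r) s0 t0) => u [cu [uc [Cu Lu]]].
    suff E : u j = c by rewrite -/(L s t r c u) -{1}E.
    have {}cu : c ≺ add (u j) s.
      by have := lt_add2r s _ _ cu; rewrite -addA addNl add0r.
    exact: Cu.
  - by have := lt_add2l (opp t) _ _ t0; rewrite add0r addNl; ord.
split.
  move=> s t s' t' r u ss tt [Lu [tu [ut Cu]]]; split; first exact: Km Lu.
  split; first by have := le_opp _ _ tt => H; exact: le_trans tu.
  split; first by ord.
  move=> b Bb bu ub; apply: Cu => //.
    by apply: lt_le_trans bu _; exact: le_add2l.
  by apply: lt_le_trans ub _; exact: le_add2l.
move=> r u Xu.
have [|s1 [t1 [s10 [t10 Ku]]]] := Ke (scons (u j) r) u; first by [].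
have [|l [r' [lu [ur HB]]]] := small_isolated (B r) (u j) _ (Bsmall r).
  by rewrite /B /bad /bounded /L /env_st; dfn.
have d1 : zero ≺ add (opp (u j)) r' by rewrite -(addNl (u j)); exact: lt_add2l.
have d2 : zero ≺ add (opp l) (u j) by rewrite -(addNl l); exact: lt_add2l.
(* The final s exceeds neither s1 nor the distances from u j to l and r', so that [B] has no other
   point within s of u j. *)
have [s2 [s20 [s21 s2r]]] := lt_min _ _ _ s10 d1.
have [s [s0 [ss2 sl]]] := lt_min _ _ _ s20 d2.
have [t [t1t [ut ut']]] : exists t, t1 ≼ t /\ u j ≼ t /\ opp (u j) ≼ t.
  have [v vt] := no_max t1; have [v' vt'] := no_max (u j).
  have [v'' vt''] := no_max (opp (u j)).
  case: (classic (v ≼ v')) => vv; case: (classic (v ≼ v'')) => vv';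
    case: (classic (v' ≼ v'')) => vv'';
    by [exists v; ord|exists v'; ord|exists v''; ord].
exists s, t; split=> //; split; first by ord.
split; first by apply: (Km s1 t1) => //; ord.
split; first by rewrite -(oppK (u j)); exact: le_opp.
split=> // b Bb bu ub; symmetry; apply: HB => //.
  apply: NNPP => /not_lt bl.
  have : add b s ≼ u j; last by ord.
  have -> : u j = add l (add (opp l) (u j)) by rewrite addA addNr add0l.
  by apply: le_trans (le_add2r s _ _ bl) _; exact: le_add2l.
apply: lt_le_trans bu _.
have -> : r' = add (u j) (add (opp (u j)) r') by rewrite addA addNr add0l.
by apply: le_add2l; ord.
Qed.

(** * The cofinal map *)

Lemma definable_cofinal_map : exists gamma : M -> M -> ('I_n -> M),
  definable_map_pos lt zero Def gamma /\
  (forall s t, zero ≺ s -> zero ≺ t -> Omega (gamma s t)) /\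
  downward_cofinal_pos lt zero Omega pre gamma.
Proof.
have dO := defset_Omega; have dP := defrel_pre.
have [||K [dK [KO [Kb [Km Ke]]]]] := exhaustion (enum 'I_n) (fun _ => Omega) dO.
- by [].
- move=> _ u u' _ _ E; apply: functional_extensionality => i.
  by apply: E; rewrite mem_enum.
have [|Y [dY [YA [Ye Yu]]]] := choice_tuple n (enum 'I_n)
  (fun r w => Omega w /\ forall u, K r u -> pre w u); first by dfn.
pose r0 : nat -> M := fun _ => zero.
pose e s t := env_st s t r0.
have Yex s t : zero ≺ s -> zero ≺ t -> exists w, Y (e s t) w.
  by move=> s0 t0; apply: Ye; exact: Kb.
(* Unless s and t are both positive, [Y] may be empty and the value is arbitrary;
   [definable_map_pos] records only positive arguments. *)
pose gamma s t := epsilon (inhabits (fun _ : 'I_n => zero)) (Y (e s t)).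
have Yg s t : zero ≺ s -> zero ≺ t -> Y (e s t) (gamma s t).
  by move=> s0 t0; apply: epsilon_spec; exact: Yex.
exists gamma; split; last split.
- have dG : defpred (fun r => zero ≺ r 0 /\ zero ≺ r 1 /\
    Y (e (r 0) (r 1)) (fun i : 'I_n => r (2 + i))).
    by rewrite /e /env_st; dfn.
  have H := defpred_Def n.+1 _ dG.
  rewrite /definable_map_pos.
  have [Hext _] := HDef; apply: (Hext (2 + n) _ _ H) => z.
  have i0 : inord 0 = lshift n ord0 :> 'I_(2 + n) by apply: val_inj; rewrite /= inordK.
  have i1 : inord 1 = lshift n ord_max :> 'I_(2 + n) by apply: val_inj; rewrite /= inordK.
  have i2 : (fun i : 'I_n => z (inord (2 + i))) = @rpart M 2 n z.
    apply: functional_extensionality => i; rewrite /rpart; congr z.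
    by apply: val_inj; rewrite /= inordK // !ltnS.
  (* By uniqueness in [Y], the definable set of [dG] is the graph of [gamma]. *)
  rewrite /lpart i0 i1 i2; split=> -[s0 [t0 H1]]; do 2!split=> //.
    by move=> i; apply: (Yu _ _ _ i H1 (Yg _ _ s0 t0)); rewrite mem_enum.
  have -> : @rpart M 2 n z = gamma (z (lshift n ord0)) (z (lshift n ord_max)).
    exact: functional_extensionality.
  exact: Yg.
- by move=> s t s0 t0; have [] := YA _ _ (Yg s t s0 t0).
move=> u Ou; have [s0 [t0 [s00 [t00 Ku]]]] := Ke r0 u Ou.
exists s0, t0; do 2!split=> //; move=> s t sp tp [/= ss tt].
have [_ H] := YA _ _ (Yg s t sp tp); apply: H.
(* Going down in [unlhd] decreases s and increases t, which enlarges [K]. *)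
exact: Km Ku.
Qed.

End LocallyOMinimal.

Theorem theorem3p15 (M : Type) (lt : M -> M -> Prop) (add : M -> M -> M)
  (zero : M) (opp : M -> M)
  (Def : forall n : nat, (('I_n -> M) -> Prop) -> Prop)
  (n : nat) (Omega : ('I_n -> M) -> Prop) (pre : ('I_n -> M) -> ('I_n -> M) -> Prop) :
  ordered_group lt add zero opp ->
  dense_no_endpoints lt ->
  definable_structure lt add Def ->
  locally_o_minimal lt Def ->
  definably_complete lt Def ->
  definable_directed_set Def Omega pre ->
  exists gamma : M -> M -> ('I_n -> M),
    definable_map_pos lt zero Def gamma /\
    (forall s t, lt zero s -> lt zero t -> Omega (gamma s t)) /\
    downward_cofinal_pos lt zero Omega pre gamma.
Proof.
move=> Hgrp Hdense HDef Hlom Hdc Hdir.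
exact: (definable_cofinal_map M lt add Def HDef zero opp Hgrp Hdense Hlom Hdc).
Qed.
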